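(* Let $\mathbf x=(x_1,\ldots,x_7)\in\mathbb C^7$. Then $\mathbf x\in G_{E(3;3;1,1,1)}$ if and only if (1) holds; likewise if and only if (2) holds; likewise if and only if (3) holds, where: (1) $(x_2,x_4,x_6)\in G_{E(2;2;1,1)}$ and $\|\Psi^{(1)}(\cdot,\mathbf x)\|_{H^\infty(\bar{\mathbb D}^2)}=\|\Psi^{(1)}(\cdot,\mathbf x)\|_{H^\infty(\mathbb T^2)}<1$, and, if $x_7=x_6x_1$, $x_3=x_2x_1$, $x_5=x_4x_1$, then $|x_1|<1$; (2) $(x_1,x_4,x_5)\in G_{E(2;2;1,1)}$ and $\|\Psi^{(2)}(\cdot,\mathbf x)\|_{H^\infty(\bar{\mathbb D}^2)}=\|\Psi^{(2)}(\cdot,\mathbf x)\|_{H^\infty(\mathbb T^2)}<1$, and, if $x_7=x_5x_2$, $x_3=x_2x_1$, $x_6=x_4x_2$, then $|x_2|<1$; (3) $(x_1,x_2,x_3)\in G_{E(2;2;1,1)}$ and $\|\Psi^{(3)}(\cdot,\mathbf x)\|_{H^\infty(\bar{\mathbb D}^2)}=\|\Psi^{(3)}(\cdot,\mathbf x)\|_{H^\infty(\mathbb T^2)}<1$, and, if $x_7=x_3x_4$, $x_6=x_2x_4$, $x_5=x_4x_1$, then $|x_4|<1$.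
   Context: $\mathbb D$ is the open unit disc, $\bar{\mathbb D}$ its closure, $\mathbb T$ the unit circle. For a linear subspace $E$ of $\mathcal M_{n\times n}(\mathbb C)$, $\mu_E(A)=1/\inf\{\|X\|: X\in E,\ \det(I-AX)=0\}$, with $\mu_E(A)=0$ if $I-AX$ is nonsingular for all $X\in E$ (operator norm). $E(2;2;1,1)$ is the space of $2\times2$ diagonal matrices and $E(3;3;1,1,1)$ the space of $3\times 3$ diagonal matrices. $G_{E(2;2;1,1)}=\{(a_{11},a_{22},\det A): A\in\mathcal M_{2\times2}(\mathbb C),\ \mu_{E(2;2;1,1)}(A)<1\}$ (the tetrablock). $G_{E(3;3;1,1,1)}=\{\pi(A): A\in\mathcal M_{3\times3}(\mathbb C),\ \mu_{E(3;3;1,1,1)}(A)<1\}$ where $$\pi(A)=\big(a_{11},\ a_{22},\ a_{11}a_{22}-a_{12}a_{21},\ a_{33},\ a_{11}a_{33}-a_{13}a_{31},\ a_{22}a_{33}-a_{23}a_{32},\ \det A\big).$$ The rational functions are $$\Psi^{(1)}(z_2,z_3,\mathbf x)=\frac{x_1-x_3z_2-x_5z_3+x_7z_2z_3}{1-x_2z_2-x_4z_3+x_6z_2z_3},\quad \Psi^{(2)}(z_1,z_3,\mathbf x)=\frac{x_2-x_3z_1-x_6z_3+x_7z_1z_3}{1-x_1z_1-x_4z_3+x_5z_1z_3},$$ $$\Psi^{(3)}(z_1,z_2,\mathbf x)=\frac{x_4-x_5z_1-x_6z_2+x_7z_1z_2}{1-x_1z_1-x_2z_2+x_3z_1z_2}.$$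 The norms $\|\cdot\|_{H^\infty(\bar{\mathbb D}^2)}$ and $\|\cdot\|_{H^\infty(\mathbb T^2)}$ are the suprema of the modulus over $\bar{\mathbb D}^2$ and $\mathbb T^2$; in each of (1), (2), (3) the tetrablock condition guarantees that the denominator has no zero on $\bar{\mathbb D}^2$. *)

(* Defs.v *)
From HB Require Import structures.
From mathcomp Require Export all_boot all_order all_algebra.
From mathcomp Require Export complex.
From mathcomp Require Export all_classical all_reals all_analysis.
Set Implicit Arguments.
Unset Strict Implicit.
Unset Printing Implicit Defensive.
Export Order.TTheory GRing.Theory Num.Theory.
Export complex.
Local Open Scope classical_set_scope.
Local Open Scope ring_scope.

Section Defs.
Variable R : realType.
Local Notation C := R[i].

Definition enorm n (v : 'cV[C]_n) : R :=
  Num.sqrt (\sum_(i < n) Normc.normc (v i ord0) ^+ 2).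

Definition opnorm n (A : 'M[C]_n) : R :=
  sup [set enorm (A *m v) | v in [set v : 'cV[C]_n | enorm v <= 1]].

Definition singset n (E : {vspace 'M[C]_n}) (A : 'M[C]_n) : set 'M[C]_n :=
  [set X | X \in E /\ \det (1%:M - A *m X) = 0].

Definition mu n (E : {vspace 'M[C]_n}) (A : 'M[C]_n) : R :=
  if `[< singset E A = set0 >] then 0
  else (inf [set opnorm X | X in singset E A])^-1.

(* E(n;n;1,...,1) *)
Definition diagE n : {vspace 'M[C]_n} := limg (linfun (@diag_mx C n)).

Lemma mem_diagE n (X : 'M[C]_n) : (X \in diagE n) = is_diag_mx X.
Proof.
apply/memv_imgP/diag_mxP => [[d _ ->]|[d ->]]; exists d => //.
- by rewrite lfunE.
- by rewrite memvf.
- by rewrite lfunE.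
Qed.

Definition tetrablock : set (C * C * C) :=
  [set (A 0 0, A 1 1, \det A) | A in [set A : 'M[C]_2 | mu (diagE 2) A < 1]].

(* Indices start at 0: the entry a_ij is A (i-1) (j-1). *)
Definition pi3 (A : 'M[C]_3) : C * C * C * C * C * C * C :=
  (A 0 0,
   A 1 1,
   A 0 0 * A 1 1 - A 0 1 * A 1 0,
   A 2 2,
   A 0 0 * A 2 2 - A 0 2 * A 2 0,
   A 1 1 * A 2 2 - A 1 2 * A 2 1,
   \det A).

Definition GE3 : set (C * C * C * C * C * C * C) :=
  [set pi3 A | A in [set A : 'M[C]_3 | mu (diagE 3) A < 1]].

Definition Psi1 (x : C * C * C * C * C * C * C) (z2 z3 : C) : C :=
  let: (x1, x2, x3, x4, x5, x6, x7) := x in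
  (x1 - x3 * z2 - x5 * z3 + x7 * z2 * z3) /
  (1 - x2 * z2 - x4 * z3 + x6 * z2 * z3).

Definition Psi2 (x : C * C * C * C * C * C * C) (z1 z3 : C) : C :=
  let: (x1, x2, x3, x4, x5, x6, x7) := x in
  (x2 - x3 * z1 - x6 * z3 + x7 * z1 * z3) /
  (1 - x1 * z1 - x4 * z3 + x5 * z1 * z3).

Definition Psi3 (x : C * C * C * C * C * C * C) (z1 z2 : C) : C :=
  let: (x1, x2, x3, x4, x5, x6, x7) := x in
  (x4 - x5 * z1 - x6 * z2 + x7 * z1 * z2) /
  (1 - x1 * z1 - x2 * z2 + x3 * z1 * z2).

Definition cdisc : set C := [set z | Normc.normc z <= 1].
Definition circle : set C := [set z | Normc.normc z = 1].

(* Extended-real valued, so that an unbounded f has norm +oo. *)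
Definition hinf (D : set (C * C)) (f : C -> C -> C) : \bar R :=
  ereal_sup [set (Normc.normc (f z.1 z.2))%:E | z in D].

End Defs.

Arguments tetrablock {R}.
Arguments GE3 {R}.
Arguments cdisc {R}.
Arguments circle {R}.

(* Main.v *)
(* For diagonal structure, mu(A) < 1 means that det (I - A diag z) has no zero
   on the closed polydisc; by compactness it then has no zero on a slightly
   larger one.  For n = 3 this determinant depends only on x = pi(A) and equals
   D(z2,z3) - z1 N(z2,z3) with Psi1 = N / D, and every x is some pi(A).
   Non-vanishing therefore means that D has no zero on the closed bidisc (the
   tetrablock condition) and that |N / D| < 1 there.  The maximum modulus
   principle is only needed for Psi1, a Moebius map in each variable.  Psi2 and
   Psi3 follow from the symmetry in z1, z2, z3. *)
Require Import Defs.
From mathcomp Require Import ring lra.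
Import numFieldNormedType.Exports.
Local Open Scope classical_set_scope.
Local Open Scope ring_scope.
Set Implicit Arguments.
Unset Strict Implicit.

(** * Modulus of complex numbers and the maximum principle for Moebius maps *)

Section ComplexModulus.
Context {R : rcfType}.
Implicit Types (x y a b c d u w z : R[i]).
Local Notation normc := (@Normc.normc R).

Lemma normc_ge0 x : 0 <= normc x.
Proof. by case: x => a b; apply: sqrtr_ge0. Qed.

Lemma sqr_normcE x : normc x ^+ 2 = Re x ^+ 2 + Im x ^+ 2.
Proof. by case: x => a b /=; rewrite sqr_sqrtr// addr_ge0// sqr_ge0. Qed.

Lemma normc_gt0 x : (0 < normc x) = (x != 0).
Proof.
rewrite lt_def normc_ge0 andbT; congr (~~ _).
by apply/eqP/eqP => [/Normc.eq0_normc//|->]; rewrite Normc.normc0.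
Qed.

Lemma normc_opp x : normc (- x) = normc x.
Proof. exact: normcN. Qed.

Lemma normcR (r : R) : 0 <= r -> normc r%:C%C = r.
Proof. by move=> r0; rewrite /= expr0n /= addr0 sqrtr_sqr ger0_norm. Qed.

(** Turns an equality of moduli into a root on the unit circle, namely -x/y, or any unit when both
    vanish. *)
Lemma normc_eq_unit x y : normc x = normc y ->
  exists2 z, normc z = 1 & x + y * z = 0.
Proof.
move=> xy; have [y0|y0] := eqVneq y 0.
  exists 1; first exact: Normc.normc1.
  rewrite y0 mul0r addr0; apply: Normc.eq0_normc.
  by rewrite xy y0 Normc.normc0.
exists (- (x / y)); last by field.
rewrite normc_opp Normc.normcM Normc.normcV xy divff//.
by rewrite gt_eqF// normc_gt0.
Qed.

Lemma affine_zero_free c d : (forall z, normc z <= 1 -> c + d * z != 0) ->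
  normc d < normc c.
Proof.
move=> cd; rewrite ltNge; apply/negP => le_cd.
have [d0|d0] := eqVneq d 0.
  move: le_cd; rewrite d0 Normc.normc0 leNgt normc_gt0 => /negP; apply.
  by have := cd 0; rewrite Normc.normc0 mulr0 addr0; apply.
have dp : 0 < normc d by rewrite normc_gt0.
have cd1 : normc (- (c / d)) <= 1.
  by rewrite normc_opp Normc.normcM Normc.normcV ler_pdivrMr// mul1r.
by case/eqP: (cd _ cd1); field.
Qed.

Lemma sqr_normc_affine a u (t : R) :
  normc (a - t%:C%C * u) ^+ 2 =
  normc u ^+ 2 * t ^+ 2 - (Re a * Re u + Im a * Im u) * t *+ 2 + normc a ^+ 2.
Proof. by rewrite !sqr_normcE; case: a u => [a1 a2] [u1 u2] /=; ring. Qed.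

(** The quadratic is nonpositive at 1 and, [T] being chosen with p T = p + |q| + |r|, nonnegative at
    [T]. *)
Lemma quadratic_ivt (p q r : R) : 0 < p -> p + q + r <= 0 ->
  exists2 t, 1 <= t & p * t ^+ 2 + q * t + r = 0.
Proof.
move=> p0 h1; pose T := 1 + (`|q| + `|r|) / p.
have T1 : 1 <= T.
  by rewrite /T lerDl divr_ge0// ?addr_ge0// ltW.
have pT : p * T = p + `|q| + `|r| by rewrite /T; field; rewrite gt_eqF.
pose P : {poly R} := p *: 'X^2 + q *: 'X + r%:P.
have PE t : P.[t] = p * t ^+ 2 + q * t + r by rewrite /P !hornerE.
have [|t /andP[t1 _] /eqP] := @poly_ivt _ P 1 T T1; last first.
  by rewrite PE; exists t.
rewrite !PE; apply/andP; split; first by rewrite expr1n !mulr1.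
have -> : p * T ^+ 2 = (p * T) * T by ring.
rewrite pT.
have := ler_norm (- q); have := ler_norm (- r); rewrite !normrN => hr hq.
have := normr_ge0 q; have := normr_ge0 r.
nra.
Qed.

(* If the value w of the quotient f at a point of the disc had modulus > M,
   consider the root of z |-> (a + b z) - t w (c + d z): it lies in the disc for
   t = 1 and outside for t large, hence crosses the circle for some t >= 1,
   where f takes the value t w. *)
Lemma moebius_maximum_modulus a b c d (M : R) : 0 <= M ->
  (forall z, normc z <= 1 -> c + d * z != 0) ->
  (forall z, normc z = 1 -> normc ((a + b * z) / (c + d * z)) <= M) ->
  forall z, normc z <= 1 -> normc ((a + b * z) / (c + d * z)) <= M.
Proof.
move=> M0 cd fM z z1; rewrite leNgt; apply/negP.
set w := _ / _ => Mw.
have w0 : 0 < normc w by apply: le_lt_trans Mw.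
have dc := affine_zero_free cd.
have zE : a - w * c = - ((b - w * d) * z).
  by rewrite /w; have := cd z z1 => h; field.
(* Coefficients in t of |a - t w c|^2 - |b - t w d|^2. This difference vanishes exactly when the
   root crosses the circle. *)
pose p := normc (w * c) ^+ 2 - normc (w * d) ^+ 2.
pose q := ((Re b * Re (w * d) + Im b * Im (w * d))
  - (Re a * Re (w * c) + Im a * Im (w * c))) *+ 2.
pose r := normc a ^+ 2 - normc b ^+ 2.
have hE t : p * t ^+ 2 + q * t + r =
    normc (a - t%:C%C * (w * c)) ^+ 2 - normc (b - t%:C%C * (w * d)) ^+ 2.
  by rewrite !sqr_normc_affine /p /q /r; ring.
have [||t t1] := @quadratic_ivt p q r.
- rewrite /p (Normc.normcM w c) (Normc.normcM w d) subr_gt0 !exprMn.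
  rewrite ltr_pM2l ?exprn_gt0//.
  by rewrite ltr_pXn2r// ?nnegrE ?normc_ge0.
- have := hE 1; rewrite expr1n !mulr1 => ->.
  rewrite !mul1r zE subr_le0 ler_pXn2r ?nnegrE ?normc_ge0//.
  by rewrite normc_opp Normc.normcM ler_piMr// normc_ge0.
rewrite hE => /eqP; rewrite subr_eq0 eqrXn2 ?normc_ge0// => /eqP.
move=> /normc_eq_unit[u u1 uE].
have := fM u u1.
have u1' : normc u <= 1 by rewrite u1.
have -> : (a + b * u) / (c + d * u) = t%:C%C * w.
  have := cd u u1' => h; apply/(canLR (mulfK h))/eqP.
  by rewrite -subr_eq0; apply/eqP; rewrite -uE; ring.
rewrite Normc.normcM normcR ?(le_trans _ t1)//.
by apply/negP; rewrite -ltNge (lt_le_trans Mw)// ler_peMl// ltW.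
Qed.

End ComplexModulus.

(** * Continuity of complex-valued functions and determinants *)

Section ContinuousComplex.
Context {R : realType} {W : topologicalType}.
Implicit Types f g : W -> R[i].

(** Stated through the two real components, so that only the topology of [R] is involved. *)
Definition ccontinuous f :=
  continuous (fun w => Re (f w) : R) /\ continuous (fun w => Im (f w) : R).

Lemma ccontinuous_cst (k : R[i]) : ccontinuous (fun=> k).
Proof. by split=> w; apply: cvg_cst. Qed.

Lemma ccontinuousD f g :
  ccontinuous f -> ccontinuous g -> ccontinuous (fun w => f w + g w).
Proof.
move=> [f1 f2] [g1 g2].
have ReD (x y : R[i]) : Re (x + y) = Re x + Re y by case: x y => [? ?] [].
have ImD (x y : R[i]) : Im (x + y) = Im x + Im y by case: x y => [? ?] [].
split=> w; [under eq_fun do rewrite ReD|under eq_fun do rewrite ImD].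
- by rewrite ?ReD; apply: cvgD; [apply: f1|apply: g1].
- by rewrite ?ImD; apply: cvgD; [apply: f2|apply: g2].
Qed.

Lemma ccontinuousM f g :
  ccontinuous f -> ccontinuous g -> ccontinuous (fun w => f w * g w).
Proof.
move=> [f1 f2] [g1 g2].
have ReM (x y : R[i]) : Re (x * y) = Re x * Re y - Im x * Im y.
  by case: x y => [? ?] [].
have ImM (x y : R[i]) : Im (x * y) = Re x * Im y + Im x * Re y.
  by case: x y => [? ?] [].
split=> w; [under eq_fun do rewrite ReM|under eq_fun do rewrite ImM].
- rewrite ?ReM; apply: cvgB; apply: cvgM.
  + exact: f1.
  + exact: g1.
  + exact: f2.
  + exact: g2.
- rewrite ?ImM; apply: cvgD; apply: cvgM.
  + exact: f1.
  + exact: g2.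
  + exact: f2.
  + exact: g1.
Qed.

Lemma ccontinuous_sum (I : Type) (r : seq I) (F : I -> W -> R[i]) :
  (forall i, ccontinuous (F i)) -> ccontinuous (fun w => \sum_(i <- r) F i w).
Proof.
move=> cF; elim: r => [|i r IH].
  by under eq_fun do rewrite big_nil; apply: ccontinuous_cst.
by under eq_fun do rewrite big_cons; apply: ccontinuousD.
Qed.

Lemma ccontinuous_prod (I : Type) (r : seq I) (F : I -> W -> R[i]) :
  (forall i, ccontinuous (F i)) -> ccontinuous (fun w => \prod_(i <- r) F i w).
Proof.
move=> cF; elim: r => [|i r IH].
  by under eq_fun do rewrite big_nil; apply: ccontinuous_cst.
by under eq_fun do rewrite big_cons; apply: ccontinuousM.
Qed.

Lemma ccontinuous_det n (A : W -> 'M[R[i]]_n) :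
  (forall i j, ccontinuous (fun w => A w i j)) ->
  ccontinuous (fun w => \det (A w)).
Proof.
move=> cA; rewrite /determinant; apply: ccontinuous_sum => s.
apply: ccontinuousM; first exact: ccontinuous_cst.
exact: ccontinuous_prod.
Qed.

Lemma ccontinuous_neq0 f w : ccontinuous f -> f w != 0 ->
  \forall v \near w, f v != 0.
Proof.
move=> [f1 f2] fw0.
have cN : {for w, continuous (fun v => Re (f v) ^+ 2 + Im (f v) ^+ 2 : R)}.
  by apply: cvgD; apply: cvgM; (exact: f1 || exact: f2).
have : \forall v \near w, 0 < Re (f v) ^+ 2 + Im (f v) ^+ 2.
  apply: (cN [set x | 0 < x]); apply: open_nbhs_nbhs.
  split; first exact: open_gt.
  by rewrite /= -sqr_normcE exprn_gt0// normc_gt0.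
apply: filterS => v; rewrite -sqr_normcE; apply: contraTneq => ->.
by rewrite Normc.normc0 expr0n ltxx.
Qed.

End ContinuousComplex.

(** * Compactness of the polydisc *)

Section Polydisc.
Context {R : realType}.

Lemma compact_unit_disc :
  compact [set p : R * R | p.1 ^+ 2 + p.2 ^+ 2 <= 1].
Proof.
have I1 := @segment_compact R (-1) 1.
apply: (subclosed_compact _ (compact_setX I1 I1)).
- have -> : [set p : R * R | p.1 ^+ 2 + p.2 ^+ 2 <= 1] =
    (fun p => p.1 ^+ 2 + p.2 ^+ 2) @^-1` [set x : R | x <= 1] by [].
  apply: preimage_closed; last exact: closed_le.
  move=> p _; apply: cvgD; apply: cvgM; (exact: cvg_fst || exact: cvg_snd).
- move=> [a b] /= ab1; rewrite !in_itv /=.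
  by split; nra.
Qed.

(* Compactness of the polydisc, used through the tube lemma in the scaling
   parameter. *)
Lemma det_polydisc_enlarge n (A : 'M[R[i]]_n) (c : R) : 0 <= c ->
  (forall d : 'rV_n, (forall i, Normc.normc (d 0 i) <= c) ->
     \det (1%:M - A *m diag_mx d) != 0) ->
  exists2 r, c < r & forall d : 'rV_n,
    (forall i, Normc.normc (d 0 i) <= r) -> \det (1%:M - A *m diag_mx d) != 0.
Proof.
move=> c0 nz.
pose T := prod_topology (fun _ : 'I_n => (R * R)%type).
pose D : set T :=
  [set v | forall i, [set p : R * R | p.1 ^+ 2 + p.2 ^+ 2 <= 1] (v i)].
have cD : compact D by exact: (tychonoff (fun _ : 'I_n => compact_unit_disc)).
(* The polydisc of radius t is t times the fixed compact [D], which makes the radius a parameter. *)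
pose dd (t : R) (v : T) : 'rV[R[i]]_n :=
  \row_i (t%:C%C * Complex (v i).1 (v i).2).
have normv (p : R * R) :
    Normc.normc (Complex p.1 p.2) ^+ 2 = p.1 ^+ 2 + p.2 ^+ 2.
  exact: sqr_normcE.
have cont : ccontinuous
    (fun w : T * R => \det (1%:M - A *m diag_mx (dd w.2 w.1))).
  apply: ccontinuous_det => i j.
  rewrite (_ : (fun _ => _) = fun w : T * R => (1%:M : 'M[R[i]]_n) i j +
    (- A i j) * (w.2%:C%C * Complex (w.1 j).1 (w.1 j).2)); last first.
    apply/funext => w; rewrite mul_mx_diag !mxE; ring.
  apply: ccontinuousD; first exact: ccontinuous_cst.
  apply: ccontinuousM; first exact: ccontinuous_cst.
  apply: ccontinuousM.
    by split=> w /=; [exact: cvg_snd|exact: cvg_cst].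
  have cj (w : T * R) : {for w, continuous (fun w : T * R => w.1 j)}.
    apply: (@continuous_comp _ _ _ fst (fun v : T => v j)).
      exact: cvg_fst.
    exact: (@proj_continuous _ (fun _ : 'I_n => (R * R)%type) j).
  split=> w /=.
    exact: (cvg_comp _ _ (cj w) cvg_fst).
  exact: (cvg_comp _ _ (cj w) cvg_snd).
have /compact_near_coveringP/(_ R (nbhs c)
    (fun t v => \det (1%:M - A *m diag_mx (dd t v)) != 0) _) := cD.
case.
  move=> v Dv.
  apply: (ccontinuous_neq0 (w := (v, c)) cont).
  apply: nz => i; rewrite mxE Normc.normcM normcR// ler_piMr//.
  by rewrite -(@expr_le1 _ 2) ?normc_ge0// normv; exact: Dv.
(* Non-vanishing holds for all radii within [e] of [c]; half of [e] stays inside this open ball. *)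
move=> e /= e0 he; exists (c + e / 2); first by rewrite ltrDl divr_gt0.
move=> d dle; set r := c + e / 2 in dle *.
have r0 : 0 < r by rewrite /r; lra.
pose v : T := fun i => (Re (d 0 i) / r, Im (d 0 i) / r).
have -> : d = dd r v.
  apply/rowP => i; rewrite mxE /v /=; case: (d 0 i) => a b /=; simpc.
  by rewrite !(mulrC r) !divfK// gt_eqF.
apply: he => /=.
  by rewrite /ball_ /r ltr_norml; lra.
move=> i /=; rewrite !expr_div_n -mulrDl -sqr_normcE ler_pdivrMr ?exprn_gt0//.
by rewrite mul1r ler_pXn2r ?nnegrE ?normc_ge0// ltW.
Qed.

End Polydisc.

(** * The structured singular value for diagonal matrices *)

Section DiagonalMu.
Context {R : realType}.
Local Notation normc := (@Normc.normc R).

Lemma enorm_sqr n (v : 'cV[R[i]]_n) :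
  enorm v ^+ 2 = \sum_(i < n) normc (v i ord0) ^+ 2.
Proof. by rewrite sqr_sqrtr// sumr_ge0// => i _; rewrite sqr_ge0. Qed.

Lemma enorm_ge0 n (v : 'cV[R[i]]_n) : 0 <= enorm v.
Proof. exact: sqrtr_ge0. Qed.

Lemma enorm_diag_le n (d : 'rV[R[i]]_n) (r : R) (v : 'cV_n) : 0 <= r ->
  (forall i, normc (d 0 i) <= r) -> enorm (diag_mx d *m v) <= r * enorm v.
Proof.
move=> r0 dr; rewrite -(@ler_pXn2r _ 2) ?nnegrE ?mulr_ge0 ?enorm_ge0//.
rewrite exprMn !enorm_sqr mulr_sumr; apply: ler_sum => i _.
rewrite mul_diag_mx mxE Normc.normcM exprMn ler_wpM2r ?sqr_ge0//.
by rewrite ler_pXn2r ?nnegrE ?normc_ge0.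
Qed.

Lemma opnorm_diag_le n (d : 'rV[R[i]]_n) (r : R) : 0 <= r ->
  (forall i, normc (d 0 i) <= r) -> opnorm (diag_mx d) <= r.
Proof.
move=> r0 dr; apply: ge_sup.
  exists (enorm (diag_mx d *m 0)); exists 0 => //=.
  rewrite -(@ler_pXn2r _ 2) ?nnegrE ?enorm_ge0// enorm_sqr.
  rewrite big1 ?expr1n ?ler01//.
  by move=> i _; rewrite mxE Normc.normc0 expr0n.
move=> _ [v /= v1 <-]; apply: le_trans (enorm_diag_le v r0 dr) _.
by rewrite ler_piMr.
Qed.

Lemma enorm_delta n (i : 'I_n) : enorm (delta_mx i ord0 : 'cV[R[i]]_n) = 1.
Proof.
apply/eqP; rewrite -(@eqrXn2 _ 2) ?enorm_ge0// enorm_sqr (bigD1 i)//= big1.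
  by rewrite mxE !eqxx Normc.normc1 addr0.
by move=> j /negPf ji; rewrite mxE ji Normc.normc0 expr0n.
Qed.

Lemma le_opnorm_diag n (d : 'rV[R[i]]_n) i :
  normc (d 0 i) <= opnorm (diag_mx d).
Proof.
have -> : normc (d 0 i) = enorm (diag_mx d *m delta_mx i ord0).
  apply/eqP; rewrite -(@eqrXn2 _ 2) ?enorm_ge0 ?normc_ge0// enorm_sqr.
  rewrite (bigD1 i)//= big1 => [|j /negPf ji].
    by rewrite mul_diag_mx !mxE !eqxx mulr1 addr0.
  by rewrite mul_diag_mx !mxE ji mulr0 Normc.normc0 expr0n.
apply: ub_le_sup; last by exists (delta_mx i ord0) => //=; rewrite enorm_delta.
(* A crude bound on the operator norm, which makes the set under the supremum bounded. *)
pose r := \sum_j normc (d 0 j).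
have r0 : 0 <= r by apply: sumr_ge0 => j _; exact: normc_ge0.
exists r => _ [v /= v1 <-]; apply: le_trans (enorm_diag_le v r0 _) _.
  move=> j; rewrite /r (bigD1 j)//= lerDl sumr_ge0// => k _.
  exact: normc_ge0.
by rewrite ler_piMr.
Qed.

Lemma singset_diagE n (A : 'M[R[i]]_n) X : singset (diagE R n) A X <->
  exists2 d, X = diag_mx d & \det (1%:M - A *m diag_mx d) = 0.
Proof.
split=> [[]|[d -> dA]].
  by rewrite mem_diagE => /diag_mxP[d ->] dA; exists d.
by split=> //; rewrite mem_diagE; apply/diag_mxP; exists d.
Qed.

(** The lower bound lies strictly above [c], so the strict inequality survives passing to the
    infimum in [mu]. *)
Lemma lt_opnorm_singset n (A : 'M[R[i]]_n) (c : R) : 0 <= c ->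
  (forall d : 'rV_n, (forall i, normc (d 0 i) <= c) ->
     \det (1%:M - A *m diag_mx d) != 0) ->
  exists2 r, c < r & lbound [set opnorm X | X in singset (diagE R n) A] r.
Proof.
move=> c0 /(det_polydisc_enlarge c0)[r cr nz]; exists r => //.
move=> _ [X /singset_diagE[d -> dA] <-]; rewrite leNgt; apply/negP => dr.
have /nz : forall i, normc (d 0 i) <= r.
  by move=> i; apply: le_trans (ltW dr); exact: le_opnorm_diag.
by rewrite dA eqxx.
Qed.

Lemma mu_diagE_lt1 n (A : 'M[R[i]]_n) :
  mu (diagE R n) A < 1 <->
  forall d : 'rV_n, (forall i, normc (d 0 i) <= 1) ->
    \det (1%:M - A *m diag_mx d) != 0.
Proof.
rewrite /mu; set S := [set opnorm X | X in _].
case: asboolP => [S0|/eqP/set0P[X0 SX0]].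
  split=> // _ d _; apply/eqP => dA.
  suff : singset (diagE R n) A (diag_mx d) by rewrite S0.
  by apply/singset_diagE; exists d.
have S0 : S !=set0 by exists (opnorm X0), X0.
(* Radius 0 contains only d = 0, where the determinant is 1. Hence the infimum is positive; were it
   0, its inverse would be 0 by convention and [mu] would be less than 1. *)
have [|r r0 rS] := @lt_opnorm_singset n A 0 (lexx 0).
  move=> d d0; have -> : d = 0.
    apply/rowP => i; rewrite mxE; apply: Normc.eq0_normc.
    by apply/eqP; rewrite eq_le normc_ge0 d0.
  by rewrite linear0 mulmx0 subr0 det1 oner_eq0.
have infS : r <= inf S by exact: lb_le_inf.
have inf0 : 0 < inf S by exact: lt_le_trans infS.
rewrite invf_lt1//; split=> [h d d1|/(lt_opnorm_singset ler01)[s s1 sS]].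
  apply/eqP => dA; move: h; rewrite ltNge => /negP; apply.
  apply: le_trans (opnorm_diag_le ler01 d1).
  apply: ge_inf; first by exists r.
  by exists (diag_mx d) => //; apply/singset_diagE; exists d.
by apply: lt_le_trans s1 _; exact: lb_le_inf.
Qed.

End DiagonalMu.

(** * Explicit determinants of sizes 2 and 3 *)

Section SmallDeterminants.
Context {K : comNzRingType}.

Lemma det2E (A : 'M[K]_2) : \det A = A 0 0 * A 1 1 - A 0 1 * A 1 0.
Proof.
(* With natural numbers as indices, the lifted ordinals of the cofactors compute, and [ring]
   recognises equal entries. *)
pose f m n := A (inord m) (inord n).
have AE i j : A i j = f i j by rewrite /f !inord_val.
rewrite (expand_det_row _ 0) !big_ord_recl big_ord0 /cofactor !det_mx11 !mxE.
by rewrite !AE /=; ring.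
Qed.

Lemma det3E (A : 'M[K]_3) : \det A =
  A 0 0 * (A 1 1 * A 2 2 - A 1 2 * A 2 1)
  - A 0 1 * (A 1 0 * A 2 2 - A 1 2 * A 2 0)
  + A 0 2 * (A 1 0 * A 2 1 - A 1 1 * A 2 0).
Proof.
pose f m n := A (inord m) (inord n).
have AE i j : A i j = f i j by rewrite /f !inord_val.
rewrite (expand_det_row _ 0) !big_ord_recl big_ord0 /cofactor !det2E !mxE.
by rewrite !AE /=; ring.
Qed.

End SmallDeterminants.

(** * Both domains as sets of zero-free polynomials *)

Section TetrablockPolynomials.
Context {R : realType}.
Local Notation C := R[i].
Local Notation normc := (@Normc.normc R).
Implicit Types A : 'M[C]_3.

Definition den2 (a b p z w : C) := 1 - a * z - b * w + p * z * w.

Lemma det_diag2 (B : 'M[C]_2) (d : 'rV_2) :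
  \det (1%:M - B *m diag_mx d) = den2 (B 0 0) (B 1 1) (\det B) (d 0 0) (d 0 1).
Proof. by rewrite !det2E /den2 mul_mx_diag !mxE /=; ring. Qed.

Lemma det_diag3 A (d : 'rV_3) :
  \det (1%:M - A *m diag_mx d) =
  let: (x1, x2, x3, x4, x5, x6, x7) := pi3 A in
  den2 x2 x4 x6 (d 0 1) (d 0 2)
    - d 0 0 * (x1 - x3 * d 0 1 - x5 * d 0 2 + x7 * d 0 1 * d 0 2).
Proof. by rewrite /pi3 !det3E /den2 mul_mx_diag !mxE /=; ring. Qed.

Lemma tetrablockP a b p : tetrablock (a, b, p) <->
  forall z w : C, normc z <= 1 -> normc w <= 1 -> den2 a b p z w != 0.
Proof.
split=> [[B /= /mu_diagE_lt1 nz [<- <- <-]] z w z1 w1|nz].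
  pose d : 'rV[C]_2 := \row_i if i == 0 then z else w.
  have /nz : forall i, normc (d 0 i) <= 1 by move=> i; rewrite mxE; case: ifP.
  by rewrite det_diag2 !mxE.
(* Determinant [p] forces the off-diagonal product to be a b - p; one entry carries all of it. *)
pose B : 'M[C]_2 := \matrix_(i, j)
  if i == 0 then if j == 0 then a else 1 else if j == 0 then a * b - p else b.
have dB : \det B = p by rewrite det2E !mxE /=; ring.
exists B; last by rewrite dB !mxE.
apply/mu_diagE_lt1 => d d1; rewrite det_diag2 dB !mxE /=.
exact: nz.
Qed.

(* The off-diagonal 2-cycles of A have prescribed products p, q, r; its two
   3-cycles have product p q r and prescribed sum, so they are the roots of a
   quadratic polynomial. *)
Lemma pi3_surj (x : C * C * C * C * C * C * C) : exists A, pi3 A = x.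
Proof.
case: x => [[[[[[x1 x2] x3] x4] x5] x6] x7].
pose p := x1 * x2 - x3; pose q := x1 * x4 - x5; pose r := x2 * x4 - x6.
(* What the Leibniz formula for the determinant leaves to the two 3-cycles. *)
pose e := x7 - x1 * x2 * x4 + x1 * r + x2 * q + x4 * p.
pose M (a12 a21 a13 a31 a23 a32 : C) : 'M[C]_3 := \matrix_(i, j)
  nth 0 (nth [::]
    [:: [:: x1; a12; a13]; [:: a21; x2; a23]; [:: a31; a32; x4]] i) j.
suff [a12 [a21 [a13 [a31 [a23 [a32 [hp hq hr he]]]]]]] :
    exists a12 a21 a13 a31 a23 a32, [/\ a12 * a21 = p, a13 * a31 = q,
      a23 * a32 = r & a12 * a23 * a31 + a13 * a21 * a32 = e].
  exists (M a12 a21 a13 a31 a23 a32); rewrite /pi3 det3E !mxE /=.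
  do ?[congr pair]; [by rewrite hp /p; ring | by rewrite hq /q; ring |
    by rewrite hr /r; ring |].
  rewrite (_ : x7 = e + x1 * x2 * x4 - x1 * r - x2 * q - x4 * p).
    by rewrite -he -hp -hq -hr; ring.
  by rewrite /e; ring.
(* The 3-cycle products are to be s and e - s. Either one root is nonzero and can be divided by, or
   both roots are 0. *)
have [[s s0 sE]|[e0 pqr0]] : (exists2 s, s != 0 & p * q * r = s * (e - s)) \/
    (e = 0 /\ p * q * r = 0).
- pose s := (e + sqrtc (e ^+ 2 - 4 * (p * q * r))) / 2.
  have sE : p * q * r = s * (e - s).
    have := sqr_sqrtc (e ^+ 2 - 4 * (p * q * r)).
    by rewrite /s; set w := sqrtc _ => wE; field: wE.
  have [s0|s0] := eqVneq s 0; last by left; exists s.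
  move: sE; rewrite s0 mul0r => ->.
  have [->|e0] := eqVneq e 0; first by right.
  by left; exists e; rewrite // subrr mulr0.
- exists 1, p, (q / s), s, 1, r; split; rewrite ?mul1r//; first by field.
  apply: (mulIf s0); rewrite mulrDl.
  transitivity (s * s + p * q * r); first by field.
  by rewrite sE; ring.
rewrite e0; move/eqP: pqr0; rewrite !mulf_eq0 -orbA => /or3P[]/eqP ->.
(* Both entries of a pair with product 0 are set to 0; each 3-cycle contains one of them and
   vanishes. *)
- by exists 0, 0, 1, q, 1, r; rewrite !mulr0 !mul0r !mul1r addr0.
- by exists 1, p, 0, 0, 1, r; rewrite !mulr0 !mul0r !mul1r addr0.
- by exists 1, p, 1, q, 0, 0; rewrite !mulr0 !mul0r !mul1r addr0.
Qed.

Lemma GE3P (x1 x2 x3 x4 x5 x6 x7 : C) : GE3 (x1, x2, x3, x4, x5, x6, x7) <->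
  forall z1 z2 z3, normc z1 <= 1 -> normc z2 <= 1 -> normc z3 <= 1 ->
  den2 x2 x4 x6 z2 z3 - z1 * (x1 - x3 * z2 - x5 * z3 + x7 * z2 * z3) != 0.
Proof.
split=> [[A /= /mu_diagE_lt1 nz piA] z1 z2 z3 hz1 hz2 hz3|nz].
  pose d : 'rV[C]_3 := \row_i nth 0 [:: z1; z2; z3] i.
  have /nz : forall i, normc (d 0 i) <= 1.
    by move=> i; rewrite mxE; case: i => [[|[|[]]]].
  by rewrite det_diag3 piA !mxE.
have [A piA] := pi3_surj (x1, x2, x3, x4, x5, x6, x7).
exists A => //; apply/mu_diagE_lt1 => d d1; rewrite det_diag3 piA; exact: nz.
Qed.

(** The slack in [z1] yields the uniform bound 1/r on [Psi1], hence a supremum strictly below 1. *)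
Lemma GE3_enlarge (x1 x2 x3 x4 x5 x6 x7 : C) :
  GE3 (x1, x2, x3, x4, x5, x6, x7) -> exists2 r : R, 1 < r &
  forall z1 z2 z3, normc z1 <= r -> normc z2 <= 1 -> normc z3 <= 1 ->
  den2 x2 x4 x6 z2 z3 - z1 * (x1 - x3 * z2 - x5 * z3 + x7 * z2 * z3) != 0.
Proof.
move=> [A /= /mu_diagE_lt1 /(det_polydisc_enlarge ler01)[r r1 nz] piA].
exists r => // z1 z2 z3 hz1 hz2 hz3.
pose d : 'rV[C]_3 := \row_i nth 0 [:: z1; z2; z3] i.
have /nz : forall i, normc (d 0 i) <= r.
  move=> i; rewrite mxE; have := ltW r1; case: i => [[|[|[]]]]//= _.
    exact: le_trans.
  exact: le_trans.
by rewrite det_diag3 piA !mxE.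
Qed.

End TetrablockPolynomials.

(** * Supremum norms of the rational functions and the three criteria *)

Section PsiCharacterization.
Context {R : realType}.
Local Notation C := R[i].
Local Notation normc := (@Normc.normc R).

Lemma circle_sub_cdisc : circle `<=` @cdisc R.
Proof. by move=> z; rewrite /circle /cdisc /= => ->. Qed.

(** The variables are moved to the circle one at a time: first [w] with [z] fixed in the disc, then
    [z] with the other already on the circle. *)
Lemma hinf_maximum_modulus (a b c e p q s : C) :
  (forall z w, normc z <= 1 -> normc w <= 1 -> den2 b c p z w != 0) ->
  let f z w := (a - e * z - q * w + s * z * w) / den2 b c p z w in
  hinf (@cdisc R `*` @cdisc R) f = hinf (@circle R `*` @circle R) f.
Proof.
move=> nz f; apply/eqP; rewrite eq_le; apply/andP; split; last first.
  apply: ereal_sup_le => _ [z [z1 z2] <-].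
  by exists z => //; split; exact: circle_sub_cdisc.
have den_l z w : den2 b c p z w = (1 - c * w) + (p * w - b) * z.
  by rewrite /den2; ring.
have den_r z w : den2 b c p z w = (1 - b * z) + (p * z - c) * w.
  by rewrite /den2; ring.
have f_l z w : f z w = ((a - q * w) + (s * w - e) * z) /
    ((1 - c * w) + (p * w - b) * z).
  by rewrite /f den_l; congr (_ / _); ring.
have f_r z w : f z w = ((a - e * z) + (s * z - q) * w) /
    ((1 - b * z) + (p * z - c) * w).
  by rewrite /f den_r; congr (_ / _); ring.
apply: ge_ereal_sup => _ [[z w] [/= z1 w1] <-].
set h := hinf _ _.
have hub u v : normc u = 1 -> normc v = 1 -> ((normc (f u v))%:E <= h)%E.
  by move=> u1 v1; apply: ereal_sup_ubound; exists (u, v).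
(* The supremum over the torus may a priori be infinite: +oo bounds everything, and -oo is excluded
   by the point (1, 1). *)
case: h hub => [M||] hub; last 2 first.
- by rewrite leey.
- by have := hub 1 1 (Normc.normc1 _) (Normc.normc1 _); rewrite leeNy_eq.
have M0 : 0 <= M.
  by apply: le_trans (normc_ge0 _) (hub 1 1 (Normc.normc1 _) (Normc.normc1 _)).
rewrite lee_fin f_r; apply: moebius_maximum_modulus => // [v v1|v v1].
  by rewrite -den_r nz.
rewrite -f_r f_l; apply: moebius_maximum_modulus => // [u u1|u u1].
  by rewrite -den_l nz ?v1.
by rewrite -f_l -lee_fin hub.
Qed.

Lemma GE3_Psi1 (x1 x2 x3 x4 x5 x6 x7 : C) :
  let x := (x1, x2, x3, x4, x5, x6, x7) in
  GE3 x <->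
     tetrablock (x2, x4, x6)
     /\ (hinf (cdisc `*` cdisc) (Psi1 x) = hinf (circle `*` circle) (Psi1 x)
         /\ (hinf (circle `*` circle) (Psi1 x) < 1%:E)%E)
     /\ (x7 = x6 * x1 -> x3 = x2 * x1 -> x5 = x4 * x1 -> normc x1 < 1).
Proof.
move=> x; split=> [Gx|[/tetrablockP nz [[hE h1] _]]].
  have [r r1 nzr] := GE3_enlarge Gx.
  have r0 : 0 < r by exact: lt_trans r1.
  have nz z w : normc z <= 1 -> normc w <= 1 -> den2 x2 x4 x6 z w != 0.
    move=> z1 w1; have := nzr 0 z w; rewrite mul0r subr0; apply=> //.
    by rewrite Normc.normc0 ltW.
  (* Were |Psi1| > 1/r, then z1 = 1/Psi1 would be a zero of D - z1 N with modulus below [r]. *)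
  have Psi_le z w : normc z <= 1 -> normc w <= 1 -> normc (Psi1 x z w) <= r^-1.
    move=> z1 w1; rewrite leNgt; apply/negP => rPsi.
    have Psi0 : Psi1 x z w != 0.
      by rewrite -normc_gt0 (lt_trans _ rPsi)// invr_gt0.
    have := nzr (Psi1 x z w)^-1 z w _ z1 w1; rewrite Normc.normcV.
    rewrite -[r in _ <= r]invrK lef_pV2 ?posrE ?invr_gt0 ?normc_gt0//.
    move=> /(_ (ltW rPsi)); move: Psi0; rewrite /Psi1 /= -/(den2 _ _ _ _ _).
    rewrite mulf_eq0 negb_or invr_eq0 => /andP[N0 D0] /eqP; apply.
    by field; rewrite D0 N0.
  have hE : hinf (cdisc `*` cdisc) (Psi1 x) = hinf (circle `*` circle) (Psi1 x).
    exact: hinf_maximum_modulus.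
  split; first by apply/tetrablockP.
  split; first split=> //.
    rewrite -hE; apply: le_lt_trans (_ : _ <= r^-1%:E)%E _.
      by apply: ge_ereal_sup => _ [[z w] [/= z1 w1] <-]; rewrite lee_fin Psi_le.
    by rewrite lte_fin invf_lt1.
  (* [x1] is the value of [Psi1] at the origin. *)
  move=> _ _ _; apply: le_lt_trans (_ : _ <= r^-1) _; last by rewrite invf_lt1.
  have := Psi_le 0 0; rewrite Normc.normc0 ler01 => /(_ isT isT).
  by rewrite /Psi1 /= !(mulr0, subr0, addr0) divr1.
(* A zero gives D = z1 N, so |D| <= |N| and |Psi1| >= 1, against the norm bound. *)
apply/GE3P => z1 z2 z3 hz1 hz2 hz3; rewrite subr_eq0; apply/negP => /eqP dE.
have D0 := nz z2 z3 hz2 hz3.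
have : ((normc (Psi1 x z2 z3))%:E < 1%:E)%E.
  apply: le_lt_trans h1; rewrite -hE.
  by apply: ereal_sup_ubound; exists (z2, z3).
rewrite lte_fin /Psi1 /= -/(den2 _ _ _ _ _) ltNge => /negP; apply.
rewrite Normc.normcM Normc.normcV ler_pdivlMr ?normc_gt0// mul1r dE.
by rewrite Normc.normcM ler_piMl// normc_ge0.
Qed.

(** Exchanging z1 and z2 exchanges [x1] with [x2] and [x5] with [x6]. At the new point [Psi1] is the
    old [Psi2]. *)
Lemma GE3_swap12 (x1 x2 x3 x4 x5 x6 x7 : C) :
  GE3 (x1, x2, x3, x4, x5, x6, x7) <-> GE3 (x2, x1, x3, x4, x6, x5, x7).
Proof.
rewrite !GE3P; split=> nz z1 z2 z3 h1 h2 h3;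
  by move: (nz z2 z1 z3 h2 h1 h3); congr (_ != 0); rewrite /den2; ring.
Qed.

(** The cyclic shift that puts z3 first; at the new point [Psi1] is the old [Psi3]. *)
Lemma GE3_rotate (x1 x2 x3 x4 x5 x6 x7 : C) :
  GE3 (x1, x2, x3, x4, x5, x6, x7) <-> GE3 (x4, x1, x5, x2, x6, x3, x7).
Proof.
rewrite !GE3P; split=> nz z1 z2 z3 h1 h2 h3.
  by move: (nz z2 z3 z1 h2 h3 h1); congr (_ != 0); rewrite /den2; ring.
by move: (nz z3 z1 z2 h3 h1 h2); congr (_ != 0); rewrite /den2; ring.
Qed.

End PsiCharacterization.

Unset Implicit Arguments.

Theorem theorem2p3 (R : realType) (x1 x2 x3 x4 x5 x6 x7 : R[i]) :
  let x := (x1, x2, x3, x4, x5, x6, x7) in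
  (GE3 x <->
     tetrablock (x2, x4, x6)
     /\ (hinf (cdisc `*` cdisc) (Psi1 x) = hinf (circle `*` circle) (Psi1 x)
         /\ (hinf (circle `*` circle) (Psi1 x) < 1%:E)%E)
     /\ (x7 = x6 * x1 -> x3 = x2 * x1 -> x5 = x4 * x1 -> Normc.normc x1 < 1))
  /\
  (GE3 x <->
     tetrablock (x1, x4, x5)
     /\ (hinf (cdisc `*` cdisc) (Psi2 x) = hinf (circle `*` circle) (Psi2 x)
         /\ (hinf (circle `*` circle) (Psi2 x) < 1%:E)%E)
     /\ (x7 = x5 * x2 -> x3 = x2 * x1 -> x6 = x4 * x2 -> Normc.normc x2 < 1))
  /\
  (GE3 x <->
     tetrablock (x1, x2, x3)
     /\ (hinf (cdisc `*` cdisc) (Psi3 x) = hinf (circle `*` circle) (Psi3 x)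
         /\ (hinf (circle `*` circle) (Psi3 x) < 1%:E)%E)
     /\ (x7 = x3 * x4 -> x6 = x2 * x4 -> x5 = x4 * x1 -> Normc.normc x4 < 1)).
Proof.
move=> x; split; first exact: GE3_Psi1.
split.
- rewrite (GE3_swap12 x1 x2) GE3_Psi1 (mulrC x2 x1); exact: iff_refl.
- rewrite (GE3_rotate x1 x2) GE3_Psi1 (mulrC x4 x1).
  (* The rotation lists the equations for [x5] and [x6] in the opposite order. *)
  split=> -[t1 [t2 t3]]; do 2?split=> //; move=> *; exact: t3.
Qed.
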